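(* Let $\alpha_j\in\mathbb{Z}_+$ ($j\in N$) and $\beta\in\mathbb{Z}_+$ with $\beta\geq\alpha_j$ for all $j\in N$. Suppose the inequality $\sum_{j\in N}\alpha_jx_j\leq\beta$ is valid for the quadratic knapsack problem, i.e. it holds for every $x\in\{0,1\}^n$ with $w^Tx\leq c$. Then every inequality in the SKILS corresponding to it, i.e. every inequality $$\sum_{k=1}^q\Big(\tilde\alpha_kX_{i_{k_0}i_{k_0}}+2\tilde\alpha_k\sum_{(i,j)\in C_{l_k}}X_{ij}\Big)\leq\beta$$ defined in the context, is valid for the lifted problem, i.e. it holds for every $(x,X)$ with $x\in\{0,1\}^n$, $w^Tx\leq c$ and $X=xx^T$. Furthermore, if $\tilde\alpha_k$ is even for every $k$ such that $|C_k|$ is odd, then these inequalities remain valid for the lifted problem when the right-hand side $\beta$ is replaced with $2\lfloor\beta/2\rfloor$.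
   Context: Let $N=\{1,\ldots,n\}$, let $w\in\mathbb{Z}^n$ have positive entries, and let $c$ be a positive integer with $c\geq w_i$ for all $i\in N$. The quadratic knapsack problem has feasible set $\{x\in\{0,1\}^n : w^Tx\leq c\}$, and its lifted version has feasible set $\{(x,X)\in\{0,1\}^n\times\mathbb{S}^n : w^Tx\leq c,\ X=xx^T\}$, where $\mathbb{S}^n$ is the set of real symmetric $n\times n$ matrices. $\mathbb{Z}_+$ is the set of nonnegative integers. Set of knapsack inequalities in the lifted space (SKILS). Let $\{C_1,\ldots,C_q\}$ be the partition of $N$ into classes on which the coefficient is constant: $\alpha_u=\alpha_v$ if $u,v$ belong to the same $C_k$, and $\alpha_u\neq\alpha_v$ otherwise. Let $\tilde\alpha_k$ be the common value of $\alpha_j$ for $j\in C_k$, so the inequality reads $\sum_{k=1}^q\tilde\alpha_k\sum_{j\in C_k}x_j\leq\beta$. For each $k=1,\ldots,q$, let $C_{l_k}$ be a set of pairs $(i,j)$ with $i<j$ that forms a partition into pairs of $C_k$ if $|C_k|$ is even, and of $C_k\setminus\{i_{k_0}\}$ for some $i_{k_0}\in C_k$ if $|C_k|$ is odd. If $|C_k|$ is even, the term $\tilde\alpha_kX_{i_{k_0}i_{k_0}}$ is absent. The SKILS is the set of all displayed inequalities over all such choices of $C_{l_k}$ and $i_{k_0}$, $k=1,\ldots,q$. *)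

(* Defs.v *)
From mathcomp Require Import all_boot all_order all_algebra.
From mathcomp Require Import reals.

Set Implicit Arguments.
Unset Strict Implicit.
Unset Printing Implicit Defensive.

Import Order.TTheory GRing.Theory Num.Theory.
Local Open Scope ring_scope.

Definition qkp_feasible (R : realType) (n : nat) (w : 'cV[int]_n) (c : int)
    (x : 'cV[R]_n) : Prop :=
  (forall i, x i 0 = 0 \/ x i 0 = 1) /\
  ((map_mx intr w)^T *m x) 0 0 <= c%:~R.

Definition lifted_feasible (R : realType) (n : nat) (w : 'cV[int]_n) (c : int)
    (x : 'cV[R]_n) (X : 'M[R]_n) : Prop :=
  [/\ qkp_feasible w c x, X^T = X & X = x *m x^T].

(* [C] enumerates without repetition the classes on which [alpha] is constant;
   [alphat k] is the value of [alpha] on [C k]. *)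
Definition coef_classes (n : nat) (alpha : 'I_n -> nat) (q : nat)
    (C : 'I_q -> {set 'I_n}) (alphat : 'I_q -> nat) : Prop :=
  [/\ injective C,
      partition [set C k | k : 'I_q] [set: 'I_n],
      forall u v, alpha u = alpha v <-> exists k, u \in C k /\ v \in C k
    & forall k j, j \in C k -> alpha j = alphat k].

(* As i < j for every pair (i, j) of [L], distinct pairs have distinct
   underlying sets {i, j}, so no pair is lost when passing to the image set. *)
Definition pair_partition (n : nat) (S : {set 'I_n}) (L : {set 'I_n * 'I_n}) :
    Prop :=
  (forall p, p \in L -> (p.1 < p.2)%N) /\
  partition [set [set p.1; p.2] | p in L] S.

(* [i0 k] is the element left unpaired in a class of odd size; its value on
   classes of even size is irrelevant, here and in [skils_lhs]. *)
Definition skils_choice (n q : nat) (C : 'I_q -> {set 'I_n})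
    (L : 'I_q -> {set 'I_n * 'I_n}) (i0 : 'I_q -> 'I_n) : Prop :=
  forall k, if odd #|C k|
    then i0 k \in C k /\ pair_partition (C k :\ i0 k) (L k)
    else pair_partition (C k) (L k).

Definition skils_lhs (R : realType) (n q : nat) (C : 'I_q -> {set 'I_n})
    (alphat : 'I_q -> nat) (L : 'I_q -> {set 'I_n * 'I_n})
    (i0 : 'I_q -> 'I_n) (X : 'M[R]_n) : R :=
  \sum_(k < q)
    ((if odd #|C k| then (alphat k)%:R * X (i0 k) (i0 k) else 0)
     + 2 * (alphat k)%:R * \sum_(p in L k) X p.1 p.2).

(* Main.v *)
Require Import Defs.
From mathcomp Require Import all_boot all_order all_algebra.
From mathcomp Require Import reals.

Set Implicit Arguments.
Unset Strict Implicit.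
Unset Printing Implicit Defensive.

Import Order.TTheory GRing.Theory Num.Theory.
Local Open Scope ring_scope.

(** On 0/1 vectors the product [x i * x j] is the conjunction of the two bits,
    and [2 * (a && b) <= a + b].  Summing this over the pairs that partition a
    class, and keeping the possible leftover element through [x i * x i = x i],
    bounds the part of the lifted left-hand side contributed by the class [C k]
    by [alphat k * \sum_(j in C k) x j] ([skils_term_le]).  As the classes
    partition the index set and [alpha] is constantly [alphat k] on [C k], these
    bounds add up to [\sum_j alpha j * x j] ([skils_value_le]), which is at most
    [beta] by validity.

    Under the parity hypothesis every contribution is even: the pairs carry a
    factor 2, and the leftover elements an even coefficient
    ([skils_value_even]).  An even natural number that is at most
    [beta] is at most [2 * (beta %/ 2)].

    The left-hand side is the image of a natural number that depends only on the
    support of [x] ([skils_lhsE]), so both arguments are carried out in [nat],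
    where parity makes sense. *)

(** Each block of the partition is a set of two distinct points, and distinct
    pairs give distinct blocks, so a sum over [S] can be regrouped pair by pair
    without loss or repetition. *)
Lemma big_pair_partition (T : Type) (idx : T) (op : Monoid.com_law idx)
    (n : nat) (S : {set 'I_n}) (L : {set 'I_n * 'I_n}) (f : 'I_n -> T) :
  pair_partition S L ->
  \big[op/idx]_(j in S) f j = \big[op/idx]_(p in L) op (f p.1) (f p.2).
Proof.
case=> ltL /and3P[/eqP <- trivL _]; rewrite big_trivIset //= big_imset /=.
  apply: eq_bigr => p /ltL lt_p.
  by rewrite big_setU1 ?inE ?big_set1 // neq_ltn lt_p.
move=> [a b] [a' b'] /ltL /= lt_ab /ltL /= lt_ab' eq_pairs.
have := set21 a b; have := set22 a b; rewrite eq_pairs !inE.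
(* Both pairs being increasing, only a = a', b = b' is possible: the crossed
   case would give a < b = a' < b' = a. *)
by move=> /orP[] /eqP eq_b /orP[] /eqP eq_a; move: lt_ab lt_ab';
   rewrite eq_a eq_b ?ltnn // => lt1 lt2; have := ltn_trans lt1 lt2;
   rewrite ltnn.
Qed.

Section SkilsValue.

Variables (n q : nat) (C : 'I_q -> {set 'I_n}) (alphat : 'I_q -> nat).
Variables (L : 'I_q -> {set 'I_n * 'I_n}) (i0 : 'I_q -> 'I_n).
Variable supp : {set 'I_n}.

(** The contribution of the class [C k] to [skils_lhs] when [X = x *m x^T] and
    [x] is the indicator vector of [supp]. *)
Definition skils_term (k : 'I_q) : nat :=
  ((if odd #|C k| then alphat k * (i0 k \in supp) else 0)
   + 2 * alphat k * \sum_(p in L k) ((p.1 \in supp) && (p.2 \in supp)))%N.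

Definition skils_value : nat := (\sum_(k < q) skils_term k)%N.

(** The inequality [2 * (a && b) <= a + b] on bits, applied to each pair. *)
Lemma pairs_le (S : {set 'I_n}) (P : {set 'I_n * 'I_n}) :
  pair_partition S P ->
  (2 * \sum_(p in P) ((p.1 \in supp) && (p.2 \in supp))
     <= \sum_(j in S) (j \in supp))%N.
Proof.
move=> partP; rewrite (big_pair_partition addn _ partP) big_distrr /=.
apply: leq_sum => p _.
by case: (p.1 \in supp); case: (p.2 \in supp).
Qed.

(** In a class of odd size the unpaired element contributes exactly its own
    term [alphat k * x (i0 k)], so only the paired elements lose anything. *)
Lemma skils_term_le (k : 'I_q) :
  skils_choice C L i0 ->
  (skils_term k <= alphat k * \sum_(j in C k) (j \in supp))%N.
Proof.
move=> /(_ k); rewrite /skils_term -mulnA mulnCA; case: ifP => _.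
  move=> [i0C /pairs_le le_pairs].
  by rewrite (big_setD1 _ i0C) /= -mulnDr leq_mul2l leq_add2l le_pairs orbT.
by move=> /pairs_le le_pairs; rewrite add0n leq_mul2l le_pairs orbT.
Qed.

Lemma skils_value_le (alpha : 'I_n -> nat) :
  coef_classes alpha C alphat -> skils_choice C L i0 ->
  (skils_value <= \sum_(j < n) alpha j * (j \in supp))%N.
Proof.
case=> injC /and3P[/eqP coverC trivC _] _ alphaE choiceL.
rewrite [leqRHS](eq_bigl (fun j => j \in [set: 'I_n])); last first.
  by move=> j; rewrite inE.
rewrite -coverC big_trivIset // big_imset; last by move=> k k' _ _ /injC.
apply: leq_sum => k _; apply: leq_trans (skils_term_le k choiceL) _.
rewrite big_distrr /=.
by apply/eq_leq/eq_bigr => j /alphaE ->.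
Qed.

Lemma skils_value_even :
  (forall k, odd #|C k| -> ~~ odd (alphat k)) -> ~~ odd skils_value.
Proof.
move=> even_alphat; rewrite /skils_value; apply: (big_ind (fun m => ~~ odd m)).
- by [].
- by move=> a b; rewrite oddD => /negPf -> /negPf ->.
move=> k _; rewrite /skils_term oddD !oddM /= addbF.
by case: ifP => // /even_alphat /negPf alphat_even; rewrite oddM alphat_even.
Qed.

End SkilsValue.

Section Lifting.

Variables (R : realType) (n : nat) (x : 'cV[R]_n).
Hypothesis x01 : forall i, x i 0 = 0 \/ x i 0 = 1.

Let supp := [set i | x i 0 == 1].

Lemma binary_indicator i : x i 0 = (i \in supp)%:R.
Proof.
rewrite inE; case: (x01 i) => ->; rewrite ?eqxx //.
by rewrite eq_sym (negPf (oner_neq0 R)).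
Qed.

Lemma skils_lhsE (q : nat) (C : 'I_q -> {set 'I_n}) (alphat : 'I_q -> nat)
    (L : 'I_q -> {set 'I_n * 'I_n}) (i0 : 'I_q -> 'I_n) :
  skils_lhs C alphat L i0 (x *m x^T) = (skils_value C alphat L i0 supp)%:R.
Proof.
have XE i j : (x *m x^T) i j = ((i \in supp) && (j \in supp))%:R.
  by rewrite mxE big_ord1 mxE !binary_indicator -natrM mulnb.
rewrite /skils_lhs /skils_value natr_sum; apply: eq_bigr => k _.
rewrite /skils_term natrD !natrM natr_sum XE andbb; congr (_ + _ * _).
  by case: ifP => // _; rewrite natrM.
by apply: eq_bigr => p _; rewrite XE.
Qed.

End Lifting.

Theorem corollary20 (R : realType) (n : nat) (w : 'cV[int]_n) (c : int)
    (w_gt0 : forall i, 0 < w i 0) (c_gt0 : 0 < c)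
    (w_le_c : forall i, w i 0 <= c)
    (alpha : 'I_n -> nat) (beta : nat)
    (alpha_le_beta : forall j, (alpha j <= beta)%N)
    (valid : forall x : 'cV[R]_n, qkp_feasible w c x ->
       \sum_(j < n) (alpha j)%:R * x j 0 <= beta%:R)
    (q : nat) (C : 'I_q -> {set 'I_n}) (alphat : 'I_q -> nat)
    (classes : coef_classes alpha C alphat) :
  (forall (L : 'I_q -> {set 'I_n * 'I_n}) (i0 : 'I_q -> 'I_n),
     skils_choice C L i0 ->
     forall (x : 'cV[R]_n) (X : 'M[R]_n), lifted_feasible w c x X ->
       skils_lhs C alphat L i0 X <= beta%:R) /\
  ((forall k, odd #|C k| -> ~~ odd (alphat k)) ->
   forall (L : 'I_q -> {set 'I_n * 'I_n}) (i0 : 'I_q -> 'I_n),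
     skils_choice C L i0 ->
     forall (x : 'cV[R]_n) (X : 'M[R]_n), lifted_feasible w c x X ->
       skils_lhs C alphat L i0 X <= (2 * (beta %/ 2))%:R).
Proof.
have value_le L i0 (x : 'cV[R]_n) : skils_choice C L i0 -> qkp_feasible w c x ->
    (skils_value C alphat L i0 [set i | x i 0 == 1]%R <= beta)%N.
  move=> choiceL feas; have [x01 _] := feas.
  apply: leq_trans (skils_value_le _ classes choiceL) _.
  rewrite -(ler_nat R) natr_sum; apply: le_trans _ (valid _ feas).
  by apply: ler_sum => j _; rewrite natrM -binary_indicator.
split=> [|even_alphat] L i0 choiceL x X [feas _ ->]; have [x01 _] := feas.
  by rewrite skils_lhsE // ler_nat value_le.
rewrite skils_lhsE // ler_nat; set v := skils_value _ _ _ _ _.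
have v_even : (2 %| v)%N by rewrite dvdn2 skils_value_even.
(* Being even, [v] equals [2 * (v %/ 2)], and halving is monotone. *)
by rewrite -(divnK v_even) mulnC leq_mul2l leq_div2r // value_le.
Qed.
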